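(* Let $n\ge 1$ and let $g_t$, $t>0$, be the Berger metrics on the sphere $S^{2n+1}$. Then: (i) for $t\geq 2n+2$, $\mathrm{Ein}(g_t)=\mathrm{ein}(g_t)=0$; (ii) for $1\leq t<2n+2$, $\mathrm{Ein}(g_t)=\frac{2n+2}{t}-1$, which ranges between $2n+1$ and $0$; (iii) for $0<t<1$, $\mathrm{Ein}(g_t)=n\left(1+\frac{2n+2}{-2t+2n+2}\right)$, which ranges between $2n$ and $2n+1$; (iv) for $n+1<t<2n+2$, $\mathrm{ein}(g_t)=n\left(1+\frac{2n+2}{-2t+2n+2}\right)$, which ranges between $0$ and $-\infty$; (v) for $0<t\leq n+1$, $\mathrm{ein}(g_t)=-\infty$.
   Context: Let $\pi:S^{2n+1}\to \mathbb{C}P^n$ be the Hopf fibration with fibers circles, where $S^{2n+1}$ carries the standard metric $g$ of constant curvature $1$ and $\mathbb{C}P^n$ (real dimension $2n$) carries the Fubini–Study metric making $\pi$ a Riemannian submersion. The Berger metric $g_t$ is obtained from $g$ by multiplying the metric by $t>0$ in the directions tangent to the fibers, leaving it unchanged on the orthogonal (horizontal) directions and keeping the two distributions orthogonal. For a metric $g$ on an $N$-manifold and real $k$, $\mathrm{Ein}_k(g):=\mathrm{Scal}\cdot g-k\,\mathrm{Ric}$, and $\mathrm{Ein}_k>0$ means positive definite at every point. If the scalar curvature of $g$ is everywhere positive, $\mathrm{Ein}(g):=\sup\{k\in(0,N):\mathrm{Ein}_k(g)>0\}$ and $\mathrm{ein}(g):=\inf\{k<0:\mathrm{Ein}_k(g)>0\}$,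 with $\mathrm{ein}(g)=-\infty$ when that set is unbounded below; otherwise $\mathrm{Ein}(g)=\mathrm{ein}(g)=0$. Here $N=2n+1$. *)

(* Defs.v *)
From mathcomp Require Import all_boot all_order all_algebra.
From mathcomp Require Import all_classical all_reals all_analysis.
From mathcomp Require Import ring lra.
Set Implicit Arguments.
Unset Strict Implicit.
Unset Printing Implicit Defensive.
Import Order.TTheory GRing.Theory Num.Theory numFieldNormedType.Exports.
Local Open Scope classical_set_scope.
Local Open Scope ring_scope.

(** A metric on [R^N] is given by its matrix field [G x = (g_ij x)]; all indices are
    those of the coordinate frame [d_0, ..., d_(N-1)]. *)

Definition pd (R : realType) (N : nat) (i : 'I_N) (f : 'rV[R]_N -> R)
  (x : 'rV[R]_N) : R := 'D_(delta_mx 0 i) f x.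

(** [christoffel G k i j] is Gamma^k_ij. *)
Definition christoffel (R : realType) (N : nat) (G : 'rV[R]_N -> 'M[R]_N)
  (k i j : 'I_N) (x : 'rV[R]_N) : R :=
  2^-1 * \sum_l invmx (G x) k l *
    (pd i (fun y => G y j l) x + pd j (fun y => G y i l) x
     - pd l (fun y => G y i j) x).

(** [riemann G l k i j] is R^l_kij, where
    [R(d_i, d_j) d_k = \sum_l R^l_kij d_l] and
    [R(X, Y) = [nabla_X, nabla_Y] - nabla_[X, Y]]. *)
Definition riemann (R : realType) (N : nat) (G : 'rV[R]_N -> 'M[R]_N)
  (l k i j : 'I_N) (x : 'rV[R]_N) : R :=
  pd i (christoffel G l j k) x - pd j (christoffel G l i k) x
  + \sum_m (christoffel G l i m x * christoffel G m j k x
            - christoffel G l j m x * christoffel G m i k x).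

(** [Ric(Y, Z)] is the trace of [X |-> R(X, Y) Z]. *)
Definition ricci (R : realType) (N : nat) (G : 'rV[R]_N -> 'M[R]_N)
  (x : 'rV[R]_N) : 'M[R]_N :=
  \matrix_(j, k) \sum_i riemann G i k i j x.

Definition scal (R : realType) (N : nat) (G : 'rV[R]_N -> 'M[R]_N)
  (x : 'rV[R]_N) : R :=
  \sum_i \sum_j invmx (G x) i j * ricci G x i j.

Definition ein_tensor (R : realType) (N : nat) (G : 'rV[R]_N -> 'M[R]_N)
  (k : R) (x : 'rV[R]_N) : 'M[R]_N :=
  scal G x *: G x - k *: ricci G x.

Definition posdef (R : realType) (N : nat) (A : 'M[R]_N) : Prop :=
  forall v : 'rV[R]_N, v != 0 -> 0 < (v *m A *m v^T) 0 0.

(** A metric on an [N]-manifold with an atlas whose charts, indexed by [I], all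
    have image [R^N], is given by its matrix in each chart.  As the charts cover
    the manifold, a pointwise tensorial condition holds at every point of the
    manifold iff it holds at every point of every chart. *)

Definition scal_pos (R : realType) (N : nat) (I : Type)
  (G : I -> 'rV[R]_N -> 'M[R]_N) : Prop :=
  forall c x, 0 < scal (G c) x.

Definition ein_pos (R : realType) (N : nat) (I : Type)
  (G : I -> 'rV[R]_N -> 'M[R]_N) (k : R) : Prop :=
  forall c x, posdef (ein_tensor (G c) k x).

Definition Ein (R : realType) (N : nat) (I : Type)
  (G : I -> 'rV[R]_N -> 'M[R]_N) : R :=
  if `[< scal_pos G >] then sup [set k | 0 < k < N%:R /\ ein_pos G k] else 0.

(** The infimum in the extended reals is [-oo] iff the set is unbounded below. *)
Definition ein (R : realType) (N : nat) (I : Type)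
  (G : I -> 'rV[R]_N -> 'M[R]_N) : \bar R :=
  if `[< scal_pos G >] then
    ereal_inf [set k%:E | k in [set k | k < 0 /\ ein_pos G k]]
  else 0%E.

(** C^(n+1) is R^(2n+2), a vector being stored as [row_mx (Re z) (Im z)]. *)

Definition dot (R : realType) (m : nat) (u v : 'rV[R]_m) : R :=
  \sum_i u 0 i * v 0 i.

Definition sphere (R : realType) (m : nat) : set 'rV[R]_m :=
  [set p | dot p p = 1].

(** Multiplication by the imaginary unit. *)
Definition mulI (R : realType) (n : nat) (z : 'rV[R]_(n.+1 + n.+1)) :
  'rV[R]_(n.+1 + n.+1) := row_mx (- rsubmx z) (lsubmx z).

(** Inverse stereographic projections from the poles [e_0] ([c = false]) and
    [- e_0] ([c = true]); these two parametrizations of the sphere by R^(2n+1)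
    are the inverses of the charts of its standard atlas.  Note that
    [1 + (n + n.+1)] and [n.+1 + n.+1] are convertible. *)
Definition stereo (R : realType) (n : nat) (c : bool) (x : 'rV[R]_(n + n.+1)) :
  'rV[R]_(n.+1 + n.+1) :=
  row_mx (((-1) ^+ c * ((dot x x - 1) / (dot x x + 1)))%:M : 'rV[R]_1)
         ((2 / (dot x x + 1)) *: x).

(** A metric on the sphere is a function [g p v w], for [p] on the sphere and [v]
    and [w] tangent to it at [p]; [sphere_metric g] is its pullback by the two
    parametrizations [stereo c]. *)
Definition sphere_metric (R : realType) (n : nat)
  (g : 'rV[R]_(n.+1 + n.+1) -> 'rV[R]_(n.+1 + n.+1) -> 'rV[R]_(n.+1 + n.+1) -> R)
  (c : bool) (x : 'rV[R]_(n + n.+1)) : 'M[R]_(n + n.+1) :=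
  \matrix_(i, j) g (stereo c x) ('D_(delta_mx 0 i) (@stereo R n c) x)
                                ('D_(delta_mx 0 j) (@stereo R n c) x).

(** A point of CP^n is a complex line of C^(n+1), and the Hopf fibration maps a
    point of the sphere to the complex line it spans. *)
Definition hopf (R : realType) (n : nat) (p : 'rV[R]_(n.+1 + n.+1)) :
  set 'rV[R]_(n.+1 + n.+1) :=
  [set q | exists a b : R, q = a *: p + b *: mulI p].

Definition hopf_fiber (R : realType) (n : nat) (p : 'rV[R]_(n.+1 + n.+1)) :
  set 'rV[R]_(n.+1 + n.+1) :=
  [set q | sphere q /\ hopf q = hopf p].

(** [hopf_circle p s = e^(i s) p] parametrizes the fiber through [p], see
    [hopf_fiberE] below. *)
Definition hopf_circle (R : realType) (n : nat) (p : 'rV[R]_(n.+1 + n.+1))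
  (s : R) : 'rV[R]_(n.+1 + n.+1) := cos s *: p + sin s *: mulI p.

(** Velocity at [p] of the fiber through [p]. *)
Definition hopf_velocity (R : realType) (n : nat) (p : 'rV[R]_(n.+1 + n.+1)) :
  'rV[R]_(n.+1 + n.+1) := derive1 (hopf_circle p) 0.

(** Orthogonal projections onto the tangent line to the fiber and onto its
    orthogonal complement. *)
Definition vertical (R : realType) (n : nat) (p v : 'rV[R]_(n.+1 + n.+1)) :
  'rV[R]_(n.+1 + n.+1) :=
  (dot v (hopf_velocity p) / dot (hopf_velocity p) (hopf_velocity p))
    *: hopf_velocity p.

Definition horizontal (R : realType) (n : nat) (p v : 'rV[R]_(n.+1 + n.+1)) :
  'rV[R]_(n.+1 + n.+1) := v - vertical p v.

Definition berger (R : realType) (n : nat) (t : R)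
  (p v w : 'rV[R]_(n.+1 + n.+1)) : R :=
  t * dot (vertical p v) (vertical p w)
  + dot (horizontal p v) (horizontal p w).

Definition berger_sphere (R : realType) (n : nat) (t : R) :
  bool -> 'rV[R]_(n + n.+1) -> 'M[R]_(n + n.+1) :=
  sphere_metric (@berger R n t).
Arguments berger_sphere {R} n t c x.

Section Facts.
Variable R : realType.

Lemma dotC m (u v : 'rV[R]_m) : dot u v = dot v u.
Proof. by apply: eq_bigr => i _; rewrite mulrC. Qed.

Lemma dotDl m (u v w : 'rV[R]_m) : dot (u + v) w = dot u w + dot v w.
Proof. by rewrite -big_split; apply: eq_bigr => i _; rewrite mxE mulrDl. Qed.

Lemma dotZl m a (u w : 'rV[R]_m) : dot (a *: u) w = a * dot u w.
Proof. by rewrite mulr_sumr; apply: eq_bigr => i _; rewrite mxE mulrA. Qed.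

Lemma dotDr m (u v w : 'rV[R]_m) : dot w (u + v) = dot w u + dot w v.
Proof. by rewrite dotC dotDl !(dotC w). Qed.

Lemma dotZr m a (u w : 'rV[R]_m) : dot w (a *: u) = a * dot w u.
Proof. by rewrite dotC dotZl dotC. Qed.

Lemma dot_ge0 m (u : 'rV[R]_m) : 0 <= dot u u.
Proof. by apply: sumr_ge0 => i _; rewrite -expr2 sqr_ge0. Qed.

Lemma dot_row_mx m1 m2 (u1 v1 : 'rV[R]_m1) (u2 v2 : 'rV[R]_m2) :
  dot (row_mx u1 u2) (row_mx v1 v2) = dot u1 v1 + dot u2 v2.
Proof.
rewrite /dot big_split_ord; congr (_ + _); apply: eq_bigr => i _.
- by rewrite !row_mxEl.
- by rewrite !row_mxEr.
Qed.

Lemma mulID n (u v : 'rV[R]_(n.+1 + n.+1)) : mulI (u + v) = mulI u + mulI v.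
Proof. by rewrite /mulI add_row_mx !linearD. Qed.

Lemma mulIZ n a (u : 'rV[R]_(n.+1 + n.+1)) : mulI (a *: u) = a *: mulI u.
Proof. by rewrite /mulI scale_row_mx !linearZ. Qed.

Lemma mulIK n (u : 'rV[R]_(n.+1 + n.+1)) : mulI (mulI u) = - u.
Proof.
by rewrite /mulI row_mxKl row_mxKr -{3}[u]hsubmxK opp_row_mx.
Qed.

Lemma dot_mulI n (u v : 'rV[R]_(n.+1 + n.+1)) :
  dot (mulI u) (mulI v) = dot u v.
Proof.
rewrite -{2}[u]hsubmxK -{2}[v]hsubmxK !dot_row_mx addrC; congr (_ + _).
by rewrite -scaleN1r -[in X in dot _ X]scaleN1r dotZl dotZr; ring.
Qed.

Lemma dot_mulIl n (u : 'rV[R]_(n.+1 + n.+1)) : dot u (mulI u) = 0.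
Proof.
rewrite -{1}[u]hsubmxK dot_row_mx -scaleN1r dotZr mulN1r.
by rewrite [X in _ + X]dotC addNr.
Qed.

Lemma hopf_velocityE n (p : 'rV[R]_(n.+1 + n.+1)) : hopf_velocity p = mulI p.
Proof.
have D i j : is_derive (0 : R) 1 (fun s => hopf_circle p s i j) (mulI p i j).
  have -> : (fun s => hopf_circle p s i j) =
      p i j \*: (cos : R -> R) + mulI p i j \*: (sin : R -> R).
    by apply/funext => s; rewrite /hopf_circle 3!mxE /= mulrC [X in _ + X]mulrC.
  apply: is_derive_eq.
  by rewrite sin0 cos0 oppr0 scaler0 add0r -[_ *: _]/(_ * _) mulr1.
have d : derivable (hopf_circle p) 0 1 by apply/derivable_mxP => i j.
rewrite /hopf_velocity derive1E derive_mx //.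
by apply/matrixP => i j; rewrite mxE derive_val.
Qed.

Lemma stereo_sphere n c (x : 'rV[R]_(n + n.+1)) : sphere (stereo c x).
Proof.
rewrite /sphere /= /stereo (@dot_row_mx 1 (n + n.+1)) {1}/dot big_ord1 !mxE /=.
rewrite dotZl dotZr !mulr1n; have := dot_ge0 x; set d := dot x x => d_ge0.
by rewrite mulrACA -expr2 sqrr_sign mul1r; field; lra.
Qed.

Lemma stereo_cover n (p : 'rV[R]_(n.+1 + n.+1)) :
  sphere p -> exists c x, stereo c x = p.
Proof.
pose a := @lsubmx R 1 1 (n + n.+1) p; pose y := @rsubmx R 1 1 (n + n.+1) p.
have pE : p = @row_mx R 1 1 (n + n.+1) a y by rewrite hsubmxK.
rewrite /sphere /= pE (@dot_row_mx 1 (n + n.+1)) {1}/dot big_ord1.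
move=> py; pose c := 0 <= a 0 0; pose b := (-1) ^+ c * a 0 0.
have b_le0 : b <= 0 by rewrite /b /c; case: (leP 0 (a 0 0)) => h /=; lra.
have bE : a 0 0 * a 0 0 = b * b by rewrite /b mulrACA -[X in _ = X * _]expr2 sqrr_sign mul1r.
have aE : a 0 0 = (-1) ^+ c * b by rewrite /b mulrA -[X in _ = X * _]expr2 sqrr_sign mul1r.
exists c, ((1 - b)^-1 *: y); rewrite /stereo dotZl dotZr.
clearbody b c a y; clear pE p.
have -> : dot y y = 1 - b * b by rewrite -bE -py addrC addKr.
apply: (f_equal2 (@row_mx R 1 1 (n + n.+1))).
  apply/matrixP => i j; rewrite !ord1 mxE eqxx mulr1n aE; congr (_ * _).
  by field; apply/andP; split; nra.
rewrite scalerA -[RHS]scale1r; congr (_ *: _).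
by field; apply/andP; split; nra.
Qed.

Lemma cos_sin_surj (a b : R) :
  a * a + b * b = 1 -> exists s, cos s = a /\ sin s = b.
Proof.
move=> ab; have a1 : -1 <= a <= 1 by apply/andP; split; nra.
have sE : sin (acos a) = `|b|.
  by rewrite sin_acos// -sqrtr_sqr; congr Num.sqrt; rewrite !expr2; lra.
have cE : cos (acos a) = a by rewrite acosK// in_itv.
have [b0|b0] := leP 0 b.
- by exists (acos a); split=> //; rewrite sE ger0_norm.
- by exists (- acos a); rewrite cosN sinN sE ltr0_norm// opprK.
Qed.

Lemma hopf_fiberE n (p : 'rV[R]_(n.+1 + n.+1)) :
  sphere p -> hopf_fiber p = range (hopf_circle p).
Proof.
rewrite /sphere /= => pp.
have dE (a b : R) :
    dot (a *: p + b *: mulI p) (a *: p + b *: mulI p) = a * a + b * b.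
  rewrite !(dotDl, dotDr, dotZl, dotZr) dot_mulI (dotC (mulI p)) dot_mulIl pp.
  by ring.
have iE (a b : R) : mulI (a *: p + b *: mulI p) = a *: mulI p - b *: p.
  by rewrite mulID !mulIZ mulIK scalerN.
apply/seteqP; split=> [q [sq hq]|_ [s _ <-]].
- have : hopf q q by exists 1, 0; rewrite scale1r scale0r addr0.
  rewrite hq => -[a [b qE]]; move: sq; rewrite /sphere /= qE dE.
  by move=> /cos_sin_surj[s [<- <-]]; exists s.
- have cs := cos2Dsin2 s; rewrite /hopf_circle.
  split; first by rewrite /sphere /= dE -!expr2.
  apply/seteqP; split=> _ [a [b ->]].
  + exists (a * cos s - b * sin s), (a * sin s + b * cos s).
    by apply/matrixP => i j; rewrite iE !mxE; ring.
  + exists (a * cos s + b * sin s), (b * cos s - a * sin s).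
    apply/matrixP => i j; rewrite iE; move: cs; rewrite !mxE.
    move: (p i j) (fun_of_matrix (mulI p) i j) (cos s) (sin s) => u v x y xy.
    by rewrite -[LHS]mul1r -xy; ring.
Qed.

End Facts.

(* Main.v *)
Require Import Defs.
From mathcomp Require Import all_boot all_order all_algebra.
From mathcomp Require Import all_classical all_reals all_analysis.
From mathcomp Require Import ring lra.
Import Order.TTheory GRing.Theory Num.Theory numFieldNormedType.Exports.
Local Open Scope classical_set_scope.
Local Open Scope ring_scope.

(** In either stereographic chart the round metric is [conf^2] times the flat one.
    With [F] the parametrization of the sphere, [E_i = d_i F] and [J] the complex
    structure, the Berger metric is [conf^2 delta + (t - 1) theta (x) theta], where
    [theta_i = <E_i, J F>] is the unit Killing form of the Hopf flow.  Write
    [omega_ij = <E_j, J E_i>].  The Gauss formula for [d_a E_i] gives, for the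
    round Levi-Civita connection [D],
      [(D_a theta)_i = omega_ai],
      [(D_a omega)_ij = g_aj theta_i - g_ai theta_j],
    and since the [E_i], rescaled, complete [F] to an orthonormal basis, [omega] is
    a complex structure on the kernel of [theta].  These identities alone yield,
    with [s = t - 1] and [N = 2n + 1], the Christoffel symbols
    [Gamma^k_ij + s (theta_i omega_jk + theta_j omega_ik) / conf^2] and
      [Ric = (N - 1 - 2s) g + (2sN + s^2 (N - 1)) theta (x) theta],
      [Scal = (N - 1)(N - s)].
    So [Ein_k > 0] is a pair of inequalities affine in [k], one for the horizontal
    and one for the vertical direction. *)

Set Implicit Arguments.
Unset Strict Implicit.
Unset Printing Implicit Defensive.

(** * Kronecker sums and directional derivatives of scalar functions *)

Lemma sum_delta (R : realType) (I : finType) (j : I) (f : I -> R) :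
  \sum_i (i == j)%:R * f i = f j.
Proof.
rewrite (bigD1 j) //= eqxx mul1r big1 ?addr0 // => i /negbTE ij.
by rewrite ij mul0r.
Qed.

Section Derive.
Variables (R : realType) (V : normedModType R).
Implicit Types (x v : V) (f g : V -> R).

(** This rule and the next ones are phrased for functions written pointwise, so that the derivative
    of an explicit formula is a term mirroring it and only an algebraic identity between values
    remains. *)
Lemma is_derive_fun_cst x v (c : R) : is_derive x v (fun=> c) 0.
Proof. exact: is_derive_cst. Qed.

Lemma is_derive_add (W : normedModType R) x v (f g : V -> W) (a b : W) :
  is_derive x v f a -> is_derive x v g b ->
  is_derive x v (fun y => f y + g y) (a + b).
Proof. exact: is_deriveD. Qed.

Lemma is_derive_mul x v f g a b :
  is_derive x v f a -> is_derive x v g b ->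
  is_derive x v (fun y => f y * g y) (a * g x + f x * b).
Proof.
move=> fa gb; apply: (is_derive_eq (is_deriveM fa gb)).
by rewrite -[LHS]/(_ * _ + _ * _) addrC [_ * a]mulrC.
Qed.

Lemma is_derive_inv x v f a :
  is_derive x v f a -> f x != 0 ->
  is_derive x v (fun y => (f y)^-1) (- (f x)^-1 ^+ 2 * a).
Proof.
move=> fa fx; apply: DeriveDef; first exact: derivableV.
by rewrite deriveV // derive_val exprVn.
Qed.

Lemma is_derive_sumr x v n (F : 'I_n -> V -> R) (a : 'I_n -> R) :
  (forall i, is_derive x v (F i) (a i)) ->
  is_derive x v (fun y => \sum_i F i y) (\sum_i a i).
Proof.
move=> Fa; rewrite (_ : (fun y => _) = \sum_i F i); first exact: is_derive_sum.
by apply/funext => y; rewrite fct_sumE.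
Qed.
End Derive.

Lemma is_derive_coord (R : realType) (N : nat) (x : 'rV[R]_N) (i j : 'I_N) :
  is_derive x (delta_mx 0 i) (fun y : 'rV[R]_N => y 0 j) (i == j)%:R.
Proof.
have d : is_derive x (delta_mx 0 i : 'rV[R]_N) id (delta_mx 0 i).
  exact: is_derive_id.
have /derivable_mxP/(_ 0 j) dj := @ex_derive _ _ _ _ _ _ _ d.
apply: DeriveDef => //.
have := derive_mx (@ex_derive _ _ _ _ _ _ _ d) => /matrixP/(_ 0 j).
by rewrite (@derive_val _ _ _ _ _ _ _ d) !mxE eqxx /= eq_sym => <-.
Qed.

(** * Curvature of [phi^2 delta + s th (x) th] *)

(* The computation at a single point [x], where [d_a phi = - phi^2 x_a] and the
   partial derivatives of [th] and [om] are [form_deriv] and [curv_deriv]. *)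
Section ContactAlgebra.
Variables (R : realType) (N : nat) (s phi r tau : R).
Variables (x th W : 'I_N -> R) (om : 'I_N -> 'I_N -> R).
Hypothesis phi_neq0 : phi != 0.
Hypothesis phir : phi * (1 + r) = 2.
Hypothesis xx : \sum_i x i * x i = r.
Hypothesis xth : \sum_i x i * th i = tau.
Hypothesis xom : forall k, \sum_i x i * om k i = W k.
Hypothesis omC : forall i j, om i j = - om j i.
Hypothesis thth : \sum_i th i * th i = phi ^+ 2.
Hypothesis omth : forall k, \sum_i om k i * th i = 0.
Hypothesis omom : forall j k,
  \sum_i om j i * om k i = phi ^+ 2 * (phi ^+ 2 * (j == k)%:R - th j * th k).

Let d (i j : 'I_N) : R := (i == j)%:R.

Let dC i j : d i j = d j i. Proof. by rewrite /d eq_sym. Qed.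

Let dii i : d i i = 1. Proof. by rewrite /d eqxx. Qed.

Let sum_d j (f : 'I_N -> R) : \sum_i d i j * f i = f j.
Proof. exact: sum_delta. Qed.

Let omii i : om i i = 0. Proof. by have := omC i i; lra. Qed.

Let sum1 : \sum_(i < N) 1 = N%:R :> R.
Proof. by rewrite sumr_const card_ord. Qed.

(* The Christoffel symbols of the metric: the first line is its round part. *)
Definition cgamma (k i j : 'I_N) : R :=
  - phi * (x i * d j k + x j * d i k - x k * d i j)
  + s * phi^-1 ^+ 2 * (th i * om j k + th j * om i k).

(* The partial derivatives of [th] and [om], read off from the covariant ones:
   [D_a th_i = om_ai] and [D_a om_ij = phi^2 (d_aj th_i - d_ai th_j)]. *)
Definition form_deriv (a i : 'I_N) : R :=
  om a i - phi * (x a * th i + x i * th a - d a i * tau).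

Definition curv_deriv (a i j : 'I_N) : R :=
  phi ^+ 2 * (d a j * th i - d a i * th j)
  - phi * (x a * om i j + x i * om a j + d a i * W j)
  - phi * (x a * om i j + x j * om i a - d a j * W i).

Definition cgamma_deriv (a k i j : 'I_N) : R :=
  phi ^+ 2 * x a * (x i * d j k + x j * d i k - x k * d i j)
  - phi * (d a i * d j k + d a j * d i k - d a k * d i j)
  + s * (2 * phi^-1 * x a * (th i * om j k + th j * om i k)
         + phi^-1 ^+ 2 * (form_deriv a i * om j k + th i * curv_deriv a j k
                          + (form_deriv a j * om i k + th j * curv_deriv a i k))).

(** Only the round part contributes, since [om] is skew and annihilates [th]. Geometrically, [s]
    rescales the volume density by a constant. *)
Lemma cgamma_trace m : \sum_i cgamma i i m = - N%:R * phi * x m.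
Proof.
transitivity (- phi * \sum_i d i m * x i - phi * x m * \sum_(i < N) 1
    + phi * \sum_i d i m * x i
    + s * phi^-1 ^+ 2 * \sum_i om m i * th i).
  rewrite -!mulNr !mulr_sumr -!big_split; apply: eq_bigr => i _ /=.
  by rewrite /cgamma omii !dii (dC m i); ring.
by rewrite !sum_d omth sum1; ring.
Qed.

Lemma sum_x_cgamma j k :
  \sum_m x m * cgamma m j k = - phi * (2 * x j * x k - r * d j k)
    + s * phi^-1 ^+ 2 * (th j * W k + th k * W j).
Proof.
transitivity (- phi * x j * \sum_m d m k * x m - phi * x k * \sum_m d m j * x m
    + phi * d j k * \sum_m x m * x m
    + s * phi^-1 ^+ 2 * th j * (\sum_m x m * om k m)
    + s * phi^-1 ^+ 2 * th k * (\sum_m x m * om j m)).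
  rewrite -!mulNr !mulr_sumr -!big_split; apply: eq_bigr => i _ /=.
  by rewrite /cgamma (dC k i) (dC j i); ring.
by rewrite !sum_d xx !xom; ring.
Qed.

Lemma sum_form_deriv_om j k : \sum_i form_deriv i j * om k i =
  - phi ^+ 2 * (phi ^+ 2 * d j k - th j * th k) - phi * (W k * th j - tau * om k j).
Proof.
transitivity (- (\sum_i om j i * om k i) - phi * th j * (\sum_i x i * om k i)
    - phi * x j * (\sum_i om k i * th i) + phi * tau * \sum_i d i j * om k i).
  rewrite -!mulNr !mulr_sumr -sumrN -!big_split; apply: eq_bigr => i _ /=.
  by rewrite /form_deriv (omC i j); ring.
by rewrite !sum_d omom xom omth /d; ring.
Qed.

Lemma sum_curv_deriv k :
  \sum_i curv_deriv i k i = phi ^+ 2 * (N%:R - 1) * th k - phi * (4 - N%:R) * W k.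
Proof.
transitivity (phi ^+ 2 * th k * \sum_(i < N) 1 - phi ^+ 2 * (\sum_i d i k * th i)
    - phi * 3 * (\sum_i x i * om k i) - phi * (\sum_i d i k * W i)
    + phi * W k * \sum_(i < N) 1).
  rewrite -!mulNr !mulr_sumr -!big_split; apply: eq_bigr => i _ /=.
  by rewrite /curv_deriv omii dii; ring.
by rewrite !sum_d sum1 xom; ring.
Qed.

(** The divergence term of the Ricci tensor; the [tau] terms cancel because [om] is skew. *)
Lemma sum_cgamma_deriv j k : \sum_i cgamma_deriv i i j k =
  phi ^+ 2 * (2 * x j * x k - r * d j k) - phi * (2 - N%:R) * d j k
  + s * (- 2 * phi ^+ 2 * d j k + 2 * N%:R * th j * th k
         + phi^-1 * (N%:R - 3) * (th j * W k + th k * W j)).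
Proof.
transitivity (phi ^+ 2 * x j * (\sum_i d i k * x i)
    + phi ^+ 2 * x k * (\sum_i d i j * x i)
    - phi ^+ 2 * d j k * (\sum_i x i * x i)
    - phi * 2 * (\sum_i d i j * d k i) + phi * d j k * (\sum_(i < N) 1)
    + s * 2 * phi^-1 * th j * (\sum_i x i * om k i)
    + s * 2 * phi^-1 * th k * (\sum_i x i * om j i)
    + s * phi^-1 ^+ 2 * (\sum_i form_deriv i j * om k i)
    + s * phi^-1 ^+ 2 * (\sum_i form_deriv i k * om j i)
    + s * phi^-1 ^+ 2 * th j * (\sum_i curv_deriv i k i)
    + s * phi^-1 ^+ 2 * th k * (\sum_i curv_deriv i j i)).
  rewrite -!mulNr !mulr_sumr -!big_split; apply: eq_bigr => i _ /=.
  by rewrite /cgamma_deriv dii (dC j i) (dC k i); ring.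
rewrite !sum_d !sum_form_deriv_om !sum_curv_deriv xx sum1 !xom (dC k j) (omC k j).
by field.
Qed.

Lemma sum_x_cgammar m k : \sum_i x i * cgamma m i k =
  - phi * (r * d k m) + s * phi^-1 ^+ 2 * (tau * om k m - th k * W m).
Proof.
transitivity (- phi * d k m * (\sum_i x i * x i)
    - phi * x k * (\sum_i d i m * x i) + phi * x m * (\sum_i d i k * x i)
    + s * phi^-1 ^+ 2 * om k m * (\sum_i x i * th i)
    - s * phi^-1 ^+ 2 * th k * (\sum_i x i * om m i)).
  rewrite -!mulNr !mulr_sumr -!big_split; apply: eq_bigr => i _ /=.
  by rewrite /cgamma (omC i m); ring.
by rewrite !sum_d xx xth xom; ring.
Qed.

Lemma sum_om_cgammar j m k : \sum_i om j i * cgamma m i k =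
  - phi * (W j * d k m + x k * om j m - x m * om j k)
  - s * th k * (phi ^+ 2 * d j m - th j * th m).
Proof.
transitivity (- phi * d k m * (\sum_i x i * om j i)
    - phi * x k * (\sum_i d i m * om j i) + phi * x m * (\sum_i d i k * om j i)
    + s * phi^-1 ^+ 2 * om k m * (\sum_i om j i * th i)
    - s * phi^-1 ^+ 2 * th k * (\sum_i om j i * om m i)).
  rewrite -!mulNr !mulr_sumr -!big_split; apply: eq_bigr => i _ /=.
  by rewrite /cgamma (omC i m); ring.
by rewrite !sum_d xom omth omom /d; field.
Qed.

Lemma sum_cgamma_cgamma j k : \sum_i \sum_m cgamma i j m * cgamma m i k =
  phi ^+ 2 * ((N%:R + 2) * x j * x k - 2 * r * d j k)
  - 3 * s * phi^-1 * (th j * W k + th k * W j)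
  - s ^+ 2 * (N%:R - 1) * th j * th k.
Proof.
(* With the sum over [i] innermost, [cgamma i j m] is a combination of Kronecker deltas, [x i],
   [om m i] and [om j i], and each piece contracts with [cgamma m i k] by a known formula. *)
rewrite exchange_big /=.
transitivity (\sum_m (- phi * x j * cgamma m m k - phi * x m * cgamma m j k
    + phi * d j m * (\sum_i x i * cgamma m i k)
    + s * phi^-1 ^+ 2 * th j * (\sum_i om m i * cgamma m i k)
    + s * phi^-1 ^+ 2 * th m * (\sum_i om j i * cgamma m i k))).
  apply: eq_bigr => m _.
  rewrite -(sum_d m (fun i => cgamma m i k)) -(sum_d j (fun i => cgamma m i k)).
  rewrite -!mulNr !mulr_sumr -!big_split; apply: eq_bigr => i _ /=.
  by rewrite {1}/cgamma (dC m i) (dC j i); ring.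
under eq_bigr => m _ do rewrite sum_x_cgammar !sum_om_cgammar dii omii.
transitivity (- phi * x j * (\sum_m cgamma m m k) - phi * (\sum_m x m * cgamma m j k)
    - phi ^+ 2 * r * (\sum_m d m j * d k m)
    + s * phi^-1 * tau * (\sum_m d m j * om k m)
    - s * phi^-1 * th k * (\sum_m d m j * W m)
    - s * phi^-1 * th j * (\sum_m d m k * W m)
    - s * phi^-1 * th j * (\sum_m x m * om k m)
    - s ^+ 2 * th j * th k * (\sum_(m < N) 1)
    + s ^+ 2 * phi^-1 ^+ 2 * th j * th k * (\sum_m th m * th m)
    - s * phi^-1 * W j * (\sum_m d m k * th m)
    - s * phi^-1 * x k * (\sum_m om j m * th m)
    + s * phi^-1 * om j k * (\sum_m x m * th m)
    - s ^+ 2 * th k * (\sum_m d m j * th m)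
    + s ^+ 2 * phi^-1 ^+ 2 * th j * th k * (\sum_m th m * th m)).
  rewrite -!mulNr !mulr_sumr -!big_split; apply: eq_bigr => m _ /=.
  by rewrite (dC k m) (dC j m) (omC m k); field.
rewrite !sum_d cgamma_trace sum_x_cgamma sum1 xom thth omth xth (dC k j) (omC k j).
by field.
Qed.

(** The left side is the coordinate formula for the Ricci tensor: the divergence of the Christoffel
    symbols, minus the derivative of their trace [- N phi x_k], plus the quadratic terms. *)
Lemma ricci_cgamma j k :
  \sum_i cgamma_deriv i i j k - N%:R * (phi ^+ 2 * x j * x k - phi * d j k)
  + \sum_i \sum_m (cgamma i i m * cgamma m j k - cgamma i j m * cgamma m i k)
  = (N%:R - 1 - 2 * s) * phi ^+ 2 * (j == k)%:R
    + (2 * s * N%:R + s ^+ 2 * (N%:R - 1)) * th j * th k.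
Proof.
have -> : \sum_i \sum_m (cgamma i i m * cgamma m j k - cgamma i j m * cgamma m i k) =
    - N%:R * phi * (\sum_m x m * cgamma m j k)
    - \sum_i \sum_m cgamma i j m * cgamma m i k.
  under eq_bigr => i _ do rewrite big_split sumrN.
  rewrite big_split sumrN /=; congr (_ - _).
  rewrite exchange_big mulr_sumr /=; apply: eq_bigr => m _.
  by rewrite -mulr_suml cgamma_trace mulrA.
rewrite sum_cgamma_deriv sum_x_cgamma sum_cgamma_cgamma -/(d j k).
(* The terms in [x j * x k] and in [W] cancel by themselves; the coefficient of [d j k] needs
   [2 - phi * r = phi]. *)
have -> : r = 2 / phi - 1 by rewrite -phir; field.
by field.
Qed.
End ContactAlgebra.

(** * From the pointwise algebra to the curvature tensors of a metric field and a positivity test *)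

Section ContactMetric.
Variables (R : realType) (N : nat) (s : R).
Variables (phi : 'rV[R]_N -> R) (th : 'I_N -> 'rV[R]_N -> R).
Variable om : 'I_N -> 'I_N -> 'rV[R]_N -> R.

Let co (x : 'rV[R]_N) (i : 'I_N) : R := x 0 i.
Let tau (x : 'rV[R]_N) : R := \sum_i x 0 i * th i x.
Let W (x : 'rV[R]_N) (k : 'I_N) : R := \sum_i x 0 i * om k i x.
Let thx (x : 'rV[R]_N) (i : 'I_N) := th i x.
Let omx (x : 'rV[R]_N) (i j : 'I_N) := om i j x.

Hypothesis s1_neq0 : s + 1 != 0.
Hypothesis phi_neq0 : forall x, phi x != 0.
Hypothesis phir : forall x, phi x * (1 + dot x x) = 2.
Hypothesis omC : forall x i j, om i j x = - om j i x.
Hypothesis thth : forall x, \sum_i th i x * th i x = phi x ^+ 2.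
Hypothesis omth : forall x k, \sum_i om k i x * th i x = 0.
Hypothesis omom : forall x j k, \sum_i om j i x * om k i x =
  phi x ^+ 2 * (phi x ^+ 2 * (j == k)%:R - th j x * th k x).
Hypothesis Dphi : forall x a,
  is_derive x (delta_mx 0 a) phi (- phi x ^+ 2 * x 0 a).
Hypothesis Dth : forall x a i, is_derive x (delta_mx 0 a) (th i)
  (form_deriv (phi x) (tau x) (co x) (thx x) (omx x) a i).
Hypothesis Dom : forall x a i j, is_derive x (delta_mx 0 a) (om i j)
  (curv_deriv (phi x) (co x) (thx x) (W x) (omx x) a i j).

Definition contact_metric (x : 'rV[R]_N) : 'M[R]_N :=
  \matrix_(i, j) (phi x ^+ 2 * (i == j)%:R + s * (th i x * th j x)).

(** Sherman-Morrison formula for a rank-one perturbation; [thth] turns its denominator into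
    [s + 1]. *)
Lemma contact_metric_inv x : invmx (contact_metric x) =
  \matrix_(i, j) ((phi x)^-1 ^+ 2 * (i == j)%:R
     - s / (s + 1) * (phi x)^-1 ^+ 4 * (th i x * th j x)).
Proof.
set B := \matrix_(i, j) _.
suff GB : contact_metric x *m B = 1%:M.
  have [uG _] := mulmx1_unit GB.
  by rewrite -[RHS]mul1mx -(mulVmx uG) -mulmxA GB mulmx1.
apply/matrixP => i j; rewrite !mxE.
transitivity (\sum_k (k == i)%:R * (k == j)%:R
  - s / (s + 1) * (phi x)^-1 ^+ 2 * th j x * \sum_k (k == i)%:R * th k x
  + s * (phi x)^-1 ^+ 2 * th i x * (\sum_k (k == j)%:R * th k x)
  - s ^+ 2 / (s + 1) * (phi x)^-1 ^+ 4 * th i x * th j x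
     * \sum_k th k x * th k x).
  rewrite -!mulNr !mulr_sumr -!big_split; apply: eq_bigr => k _ /=.
  by rewrite !mxE (eq_sym i k); field; rewrite phi_neq0 s1_neq0.
by rewrite !sum_delta thth; field; rewrite phi_neq0 s1_neq0.
Qed.

Lemma pd_contact_metric x a i j :
  pd a (fun y => contact_metric y i j) x =
  - 2 * phi x ^+ 3 * x 0 a * (i == j)%:R
  + s * (form_deriv (phi x) (tau x) (co x) (thx x) (omx x) a i * th j x
         + th i x * form_deriv (phi x) (tau x) (co x) (thx x) (omx x) a j).
Proof.
have -> : (fun y => contact_metric y i j) =
    (fun y => phi y * phi y * (i == j)%:R + s * (th i y * th j y)).
  by apply/funext => y; rewrite mxE expr2.
have D := is_derive_add
  (is_derive_mul (is_derive_mul (Dphi x a) (Dphi x a)) (is_derive_fun_cst x _ (i == j)%:R))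
  (is_derive_mul (is_derive_fun_cst x _ s) (is_derive_mul (Dth x a i) (Dth x a j))).
by rewrite /pd (@derive_val _ _ _ _ _ _ _ D); ring.
Qed.

Lemma christoffel_contact x k i j : christoffel contact_metric k i j x =
  cgamma s (phi x) (co x) (thx x) (omx x) k i j.
Proof.
(* [H] is the Christoffel symbol of the first kind, [gij] the round symbol with its index raised,
   and [gth] the contraction of [gij] with [th]. *)
pose gij l :=
  - phi x * (x 0 i * (j == l)%:R + x 0 j * (i == l)%:R - x 0 l * (i == j)%:R).
pose gth := - phi x * (x 0 i * th j x + x 0 j * th i x - (i == j)%:R * tau x).
pose H l := phi x ^+ 2 * gij l
  + s * (gth * th l x + th j x * om i l x + th i x * om j l x).
rewrite /christoffel.
transitivity (\sum_l invmx (contact_metric x) k l * H l).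
  rewrite mulr_sumr; apply: eq_bigr => l _; rewrite mulrCA; congr (_ * _).
  rewrite !pd_contact_metric /H /gij /gth /form_deriv /co /thx /omx.
  rewrite (omC x j i) (omC x l i) (omC x l j) (eq_sym j i) (eq_sym l i) (eq_sym l j).
  by field.
(* The inverse metric is scalar plus rank one, so raising the index needs only [H k] and this
   contraction, from which the [om] terms drop out. *)
have thH : \sum_l th l x * H l = (s + 1) * phi x ^+ 2 * gth.
  transitivity (- phi x ^+ 3 * x 0 i * (\sum_l (l == j)%:R * th l x)
     - phi x ^+ 3 * x 0 j * (\sum_l (l == i)%:R * th l x)
     + phi x ^+ 3 * (i == j)%:R * tau x
     + s * gth * (\sum_l th l x * th l x)
     + s * th j x * (\sum_l om i l x * th l x)
     + s * th i x * (\sum_l om j l x * th l x)).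
    rewrite -!mulNr !mulr_sumr -!big_split; apply: eq_bigr => l _ /=.
    by rewrite /H /gij (eq_sym l i) (eq_sym l j); ring.
  by rewrite !sum_delta thth !omth /gth; ring.
transitivity ((phi x)^-1 ^+ 2 * (\sum_l (l == k)%:R * H l)
    - s / (s + 1) * (phi x)^-1 ^+ 4 * th k x * (\sum_l th l x * H l)).
  rewrite -!mulNr !mulr_sumr -!big_split; apply: eq_bigr => l _ /=.
  by rewrite contact_metric_inv mxE (eq_sym l k); ring.
rewrite sum_delta thH /H /gij /cgamma /co /thx /omx.
by field; rewrite phi_neq0 s1_neq0.
Qed.

Lemma is_derive_christoffel_contact x a k i j :
  is_derive x (delta_mx 0 a) (christoffel contact_metric k i j)
    (cgamma_deriv s (phi x) (tau x) (co x) (thx x) (W x) (omx x) a k i j).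
Proof.
have -> : christoffel contact_metric k i j = (fun y =>
    - 1 * (phi y * (y 0 i * (j == k)%:R
                    + (y 0 j * (i == k)%:R + - 1 * (y 0 k * (i == j)%:R))))
    + s * ((phi y)^-1 * (phi y)^-1 * (th i y * om j k y + th j y * om i k y))).
  by apply/funext => y; rewrite christoffel_contact /cgamma /co /thx /omx; ring.
have Dc := @is_derive_fun_cst _ _ x (delta_mx 0 a).
have Di := is_derive_inv (Dphi x a) (phi_neq0 x).
have Dx := is_derive_coord x a.
apply: (is_derive_eq (is_derive_add
  (is_derive_mul (Dc (- 1)) (is_derive_mul (Dphi x a)
    (is_derive_add (is_derive_mul (Dx i) (Dc (j == k)%:R))
    (is_derive_add (is_derive_mul (Dx j) (Dc (i == k)%:R))
      (is_derive_mul (Dc (- 1)) (is_derive_mul (Dx k) (Dc (i == j)%:R)))))))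
  (is_derive_mul (Dc s) (is_derive_mul (is_derive_mul Di Di)
    (is_derive_add (is_derive_mul (Dth x a i) (Dom x a j k))
                   (is_derive_mul (Dth x a j) (Dom x a i k))))))).
by rewrite /cgamma_deriv /co /thx /omx; field; rewrite phi_neq0.
Qed.

(** The sum of the derivatives is the derivative of the trace, which has a closed form; this avoids
    a second trace of [cgamma_deriv]. *)
Lemma sum_pd_christoffel_contact x j k :
  \sum_i pd j (christoffel contact_metric i i k) x =
  N%:R * (phi x ^+ 2 * x 0 j * x 0 k - phi x * (j == k)%:R).
Proof.
under eq_bigr => i _ do
  rewrite /pd (@derive_val _ _ _ _ _ _ _ (is_derive_christoffel_contact x j i i k)).
have D1 := is_derive_sumr (fun i => is_derive_christoffel_contact x j i i k).
rewrite -(@derive_val _ _ _ _ _ _ _ D1).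
have -> : (fun y => \sum_i christoffel contact_metric i i k y) =
    (fun y => - N%:R * (phi y * y 0 k)).
  apply/funext => y; under eq_bigr => i _ do rewrite christoffel_contact.
  by rewrite (cgamma_trace _ _ _ (omC y) (omth y)) mulrA.
have D2 := is_derive_mul (is_derive_fun_cst x (delta_mx 0 j) (- N%:R))
  (is_derive_mul (Dphi x j) (is_derive_coord x j k)).
by rewrite (@derive_val _ _ _ _ _ _ _ D2); ring.
Qed.

Lemma ricci_contact x : ricci contact_metric x = \matrix_(j, k)
  ((N%:R - 1 - 2 * s) * phi x ^+ 2 * (j == k)%:R
   + (2 * s * N%:R + s ^+ 2 * (N%:R - 1)) * th j x * th k x).
Proof.
apply/matrixP => j k; rewrite /ricci !mxE /riemann.
rewrite big_split sumrB /=.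
rewrite -(ricci_cgamma s (phi_neq0 x) (phir x) erefl erefl (fun=> erefl)
  (omC x) (thth x) (omth x) (omom x)).
congr (_ - _ + _).
- apply: eq_bigr => i _.
  by rewrite /pd (@derive_val _ _ _ _ _ _ _ (is_derive_christoffel_contact x i i j k)).
- exact: sum_pd_christoffel_contact.
- by do 2!apply: eq_bigr => ? _; rewrite !christoffel_contact.
Qed.

(** Writing the Ricci tensor as [a phi^2 delta + b th (x) th], each of the [N - 1] horizontal
    directions contributes [a] and the vertical one [(a + b) / (s + 1)]. *)
Lemma scal_contact x : scal contact_metric x = (N%:R - 1) * (N%:R - s).
Proof.
rewrite /scal contact_metric_inv ricci_contact.
set a := N%:R - 1 - 2 * s; set b := 2 * s * N%:R + s ^+ 2 * (N%:R - 1).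
transitivity (\sum_i ((a + (phi x)^-1 ^+ 2
    * (b - s / (s + 1) * (a + b)) * (th i x * th i x)) * 1)).
  apply: eq_bigr => i _.
  transitivity (a * \sum_j (j == i)%:R * (j == i)%:R
    + (phi x)^-1 ^+ 2 * (b - s / (s + 1) * a) * th i x * (\sum_j (j == i)%:R * th j x)
    - s / (s + 1) * (phi x)^-1 ^+ 4 * b * th i x ^+ 2 * \sum_j th j x * th j x).
    rewrite -!mulNr !mulr_sumr -!big_split; apply: eq_bigr => j _ /=.
    by rewrite !mxE (eq_sym i j); field; rewrite phi_neq0 s1_neq0.
  by rewrite !sum_delta thth eqxx /=; field; rewrite phi_neq0 s1_neq0.
rewrite -mulr_suml big_split /= -mulr_sumr thth sumr_const card_ord -mulr_natr /a /b.
by field; rewrite phi_neq0 s1_neq0.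
Qed.

(** The form splits along [th] and its orthogonal complement, with eigenvalues proportional to
    [a + b] and [a]; [1 < N] makes the complement nonzero. *)
Lemma posdef_contact x (a b : R) : (1 < N)%N ->
  posdef (\matrix_(i, j) (a * phi x ^+ 2 * (i == j)%:R + b * (th i x * th j x)))
  <-> 0 < a /\ 0 < a + b.
Proof.
move=> N1; set A := \matrix_(i, j) _.
have phi2 : 0 < phi x ^+ 2 by rewrite exprn_even_gt0 //= phi_neq0.
have AE (v : 'rV[R]_N) : (v *m A *m v^T) 0 0 =
    a * phi x ^+ 2 * dot v v + b * (\sum_i v 0 i * th i x) ^+ 2.
  rewrite mxE.
  transitivity (\sum_j (a * phi x ^+ 2 * (v 0 j * v 0 j)
      + b * (\sum_i v 0 i * th i x) * (v 0 j * th j x))).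
    apply: eq_bigr => j _; rewrite !mxE.
    transitivity (v 0 j * (a * phi x ^+ 2 * (\sum_i (i == j)%:R * v 0 i)
        + b * th j x * \sum_i v 0 i * th i x)).
      rewrite [LHS]mulrC; congr (_ * _).
      rewrite !mulr_sumr -big_split /=; apply: eq_bigr => i _.
      by rewrite mxE; ring.
    by rewrite sum_delta; ring.
  by rewrite big_split /= -!mulr_sumr /dot; ring.
have dot_gt0 (v : 'rV[R]_N) : v != 0 -> 0 < dot v v.
  move=> v0; rewrite lt_neqAle dot_ge0 andbT eq_sym; apply: contra_neq v0.
  move=> /eqP; rewrite psumr_eq0 => [/allP vv|i _]; last exact: sqr_ge0.
  apply/rowP => i; rewrite mxE; apply/eqP.
  by have := vv i (mem_index_enum i); rewrite mulf_eq0 orbb.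
split=> [Apos|[a0 ab0] v v0].
  split.
    rewrite ltNge; apply/negP => a_le0.
    (* Rows of [om] are orthogonal to [th], so a nonzero one contradicts [a <= 0]. If all vanished,
       so would the sum of their squared norms, which is [phi^4 (N - 1)]. *)
    have om0 j k : om j k x = 0.
      pose v : 'rV[R]_N := \row_k om j k x.
      suff /eqP/rowP/(_ k) : v == 0 by rewrite !mxE.
      apply: contraT => v0; have := Apos _ v0; rewrite AE.
      have -> : \sum_i v 0 i * th i x = 0.
        by rewrite -[RHS](omth x j); apply: eq_bigr => i _; rewrite mxE.
      by rewrite expr0n mulr0 addr0 -mulrA pmulr_lgt0 ?(mulr_gt0 phi2 (dot_gt0 _ v0)) //; lra.
    have : \sum_j \sum_i om j i x * om j i x = phi x ^+ 4 * (N%:R - 1).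
      under eq_bigr => j _ do rewrite omom eqxx mulr1.
      rewrite -mulr_sumr sumrB thth sumr_const card_ord -mulr_natr; ring.
    rewrite big1; last by move=> j _; rewrite big1 // => i _; rewrite om0 mul0r.
    apply/eqP; rewrite eq_sym mulf_neq0 ?expf_neq0 //.
    by rewrite subr_eq0 pnatr_eq1; case: eqP N1 => // ->.
  pose v : 'rV[R]_N := \row_k th k x.
  have vv : dot v v = phi x ^+ 2.
    by rewrite -thth; apply: eq_bigr => i _; rewrite !mxE.
  have vth : \sum_i v 0 i * th i x = phi x ^+ 2.
    by rewrite -thth; apply: eq_bigr => i _; rewrite !mxE.
  have v0 : v != 0.
    apply: contraTneq phi2 => v0; rewrite -vv v0 /dot big1 ?ltxx // => i _.
    by rewrite mxE mul0r.
  have := Apos _ v0; rewrite AE vv vth.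
  have -> : a * phi x ^+ 2 * phi x ^+ 2 + b * (phi x ^+ 2) ^+ 2 =
      (a + b) * (phi x ^+ 2 * phi x ^+ 2) by ring.
  by rewrite pmulr_lgt0 // mulr_gt0.
rewrite AE; move qE: (\sum_i v 0 i * th i x) => q.
(* Cauchy-Schwarz, from the square of the component of [v] orthogonal to [th]. *)
have CS : q ^+ 2 <= phi x ^+ 2 * dot v v.
  pose w i := phi x ^+ 2 * v 0 i - q * th i x.
  have : 0 <= \sum_i w i * w i by apply: sumr_ge0 => i _; exact: sqr_ge0.
  have -> : \sum_i w i * w i = phi x ^+ 2 * (phi x ^+ 2 * dot v v - q ^+ 2).
    transitivity (phi x ^+ 4 * (\sum_i v 0 i * v 0 i)
        - 2 * q * phi x ^+ 2 * (\sum_i v 0 i * th i x)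
        + q ^+ 2 * \sum_i th i x * th i x).
      rewrite -!mulNr !mulr_sumr -!big_split; apply: eq_bigr => i _ /=.
      by rewrite /w; ring.
    by rewrite thth qE /dot; ring.
  by rewrite pmulr_rge0 // subr_ge0.
have pv : 0 < phi x ^+ 2 * dot v v by rewrite mulr_gt0 // dot_gt0.
have := sqr_ge0 q; rewrite -mulrA; move: CS pv.
move: (phi x ^+ 2 * dot v v) (q ^+ 2) => p q2 q2p p0 q20.
(* The form is [a p + b q2] with [0 <= q2 <= p]: at least [a p] if [b >= 0], and at least
   [(a + b) p] otherwise. *)
by have [b0|b0] := leP 0 b; nra.
Qed.

(** The tensor again has the shape handled by [posdef_contact]; the positive factor [(N - 1)(s + 1)]
    of its vertical coefficient is divided out. *)
Lemma posdef_ein_contact k x : (1 < N)%N -> 0 < s + 1 ->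
  posdef (ein_tensor contact_metric k x) <->
  0 < (N%:R - 1) * (N%:R - s) - k * (N%:R - 1 - 2 * s)
  /\ 0 < (N%:R - s) - k * (s + 1).
Proof.
move=> N1 s1.
set a := N%:R - 1 - 2 * s; set b := 2 * s * N%:R + s ^+ 2 * (N%:R - 1).
have -> : ein_tensor contact_metric k x = \matrix_(i, j)
   (((N%:R - 1) * (N%:R - s) - k * a) * phi x ^+ 2 * (i == j)%:R
    + ((N%:R - 1) * (N%:R - s) * s - k * b) * (th i x * th j x)).
  apply/matrixP => i j.
  by rewrite /ein_tensor scal_contact ricci_contact !mxE -/a -/b; ring.
rewrite posdef_contact //.
have -> : (N%:R - 1) * (N%:R - s) - k * a + ((N%:R - 1) * (N%:R - s) * s - k * b)
   = (N%:R - 1) * (s + 1) * ((N%:R - s) - k * (s + 1)) by rewrite /a /b; ring.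
have N0 : 0 < (N%:R - 1 : R) by rewrite subr_gt0 ltr1n.
by rewrite (pmulr_rgt0 _ (mulr_gt0 N0 s1)).
Qed.
End ContactMetric.

(** * Derivatives of matrix-valued maps, and identities for [dot] and [mulI] *)

Section VectorDerive.
Variables (R : realType) (V : normedModType R) (x v : V).

Lemma is_derive_mx m n (f : V -> 'M[R]_(m, n)) (a : 'M[R]_(m, n)) :
  (forall i j, is_derive x v (fun y => f y i j) (a i j)) -> is_derive x v f a.
Proof.
move=> fa; have d : derivable f x v by apply/derivable_mxP => i j; case: (fa i j).
apply: DeriveDef => //; rewrite derive_mx //.
by apply/matrixP => i j; rewrite mxE (@derive_val _ _ _ _ _ _ _ (fa i j)).
Qed.

Lemma is_derive_mx_entry m n (f : V -> 'M[R]_(m, n)) (a : 'M[R]_(m, n)) i j :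
  is_derive x v f a -> is_derive x v (fun y => f y i j) (a i j).
Proof.
move=> fa; have d := @ex_derive _ _ _ _ _ _ _ fa.
apply: DeriveDef; first by have /derivable_mxP := d; apply.
by rewrite -(@derive_val _ _ _ _ _ _ _ fa) derive_mx // mxE.
Qed.

Lemma is_derive_scale m n (f : V -> R) (g : V -> 'M[R]_(m, n)) a (b : 'M[R]_(m, n)) :
  is_derive x v f a -> is_derive x v g b ->
  is_derive x v (fun y => f y *: g y) (a *: g x + f x *: b).
Proof.
move=> fa gb; apply: is_derive_mx => i j.
rewrite (_ : (fun y => _) = (fun y => f y * g y i j)); last first.
  by apply/funext => y; rewrite mxE.
rewrite !mxE; apply: is_derive_mul => //; exact: is_derive_mx_entry.
Qed.

Lemma is_derive_row_mx m n1 n2 (f : V -> 'M[R]_(m, n1)) (g : V -> 'M[R]_(m, n2))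
    (a : 'M[R]_(m, n1)) (b : 'M[R]_(m, n2)) :
  is_derive x v f a -> is_derive x v g b ->
  is_derive x v (fun y => row_mx (f y) (g y)) (row_mx a b).
Proof.
move=> fa gb; apply: is_derive_mx => i j.
rewrite (_ : (fun y => _) = (fun y => match fintype.split j with
    inl k => f y i k | inr k => g y i k end)); last first.
  by apply/funext => y; rewrite mxE.
by rewrite mxE; case: (fintype.split j) => k; exact: is_derive_mx_entry.
Qed.

Lemma is_derive_mulI n (f : V -> 'rV[R]_(n.+1 + n.+1)) (a : 'rV[R]_(n.+1 + n.+1)) :
  is_derive x v f a -> is_derive x v (fun y => mulI (f y)) (mulI a).
Proof.
move=> fa; apply: is_derive_row_mx; apply: is_derive_mx => i j.
  rewrite (_ : (fun y => _) = (fun y => - 1 * f y i (rshift n.+1 j))); last first.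
    by apply/funext => y; rewrite !mxE mulN1r.
  apply: (is_derive_eq (is_derive_mul (is_derive_fun_cst x v (- 1))
    (is_derive_mx_entry i (rshift n.+1 j) fa))).
  by rewrite !mxE mul0r add0r mulN1r.
rewrite (_ : (fun y => _) = (fun y => f y i (lshift n.+1 j))); last first.
  by apply/funext => y; rewrite !mxE.
by rewrite mxE; exact: is_derive_mx_entry.
Qed.

Lemma is_derive_dot m (f g : V -> 'rV[R]_m) (a b : 'rV[R]_m) :
  is_derive x v f a -> is_derive x v g b ->
  is_derive x v (fun y => dot (f y) (g y)) (dot a (g x) + dot (f x) b).
Proof.
move=> fa gb; rewrite /dot -big_split; apply: is_derive_sumr => i.
by apply: is_derive_mul; exact: is_derive_mx_entry.
Qed.
End VectorDerive.

Section Dot.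
Variable R : realType.

Lemma dotNl m (u v : 'rV[R]_m) : dot (- u) v = - dot u v.
Proof. by rewrite -scaleN1r dotZl mulN1r. Qed.

Lemma dotNr m (u v : 'rV[R]_m) : dot v (- u) = - dot v u.
Proof. by rewrite dotC dotNl dotC. Qed.

Lemma dot_deltal m (x : 'rV[R]_m) i : dot (delta_mx 0 i) x = x 0 i.
Proof.
rewrite -(sum_delta i (fun j => x 0 j)); apply: eq_bigr => j _.
by rewrite mxE eqxx.
Qed.

Lemma dot_mulI_skew n (u v : 'rV[R]_(n.+1 + n.+1)) :
  dot u (mulI v) = - dot v (mulI u).
Proof.
by rewrite -(dot_mulI v) mulIK -(scaleN1r u) dotZr dotC mulN1r opprK.
Qed.
End Dot.

(** * Berger metrics in the stereographic charts *)

Section Stereo.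
Variables (R : realType) (n : nat) (c : bool).
Implicit Types (x : 'rV[R]_(n + n.+1)) (u v w : 'rV[R]_(n.+1 + n.+1)).

Definition conf x : R := 2 / (dot x x + 1).

Definition stereo_frame x (i : 'I_(n + n.+1)) : 'rV[R]_(n.+1 + n.+1) :=
  @row_mx R 1 1 (n + n.+1) (((-1) ^+ c * (conf x ^+ 2 * x 0 i))%:M)
    (conf x *: (delta_mx 0 i - (conf x * x 0 i) *: x)).

(* The connection one-form [theta] of the Hopf fibration, and half of [d theta]. *)
Definition hopf_form (i : 'I_(n + n.+1)) x : R :=
  dot (stereo_frame x i) (mulI (stereo c x)).

Definition hopf_curv (i j : 'I_(n + n.+1)) x : R :=
  dot (stereo_frame x j) (mulI (stereo_frame x i)).

Lemma conf_neq0 x : conf x != 0.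
Proof. by rewrite mulf_neq0 ?invr_neq0 //; have := dot_ge0 x; lra. Qed.

Lemma confE x : conf x * (1 + dot x x) = 2.
Proof. by rewrite /conf; field; have := dot_ge0 x; lra. Qed.

Lemma is_derive_conf x i :
  is_derive x (delta_mx 0 i) conf (- conf x ^+ 2 * x 0 i).
Proof.
have Dx : is_derive x (delta_mx 0 i : 'rV[R]_(n + n.+1)) id (delta_mx 0 i).
  exact: is_derive_id.
have xx1 : dot x x + 1 != 0 by have := dot_ge0 x; lra.
have Dr := is_derive_add (is_derive_dot Dx Dx) (is_derive_fun_cst x _ 1).
apply: (is_derive_eq (is_derive_mul (is_derive_fun_cst x _ 2)
  (is_derive_inv Dr xx1))).
by rewrite /= (dotC x (delta_mx 0 i)) !dot_deltal /conf; field.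
Qed.

Lemma stereoE x : stereo c x =
  @row_mx R 1 1 (n + n.+1) (((-1) ^+ c * (1 - conf x))%:M) (conf x *: x).
Proof.
rewrite /stereo; congr (@row_mx R 1 1 (n + n.+1) (_%:M) _); congr (_ * _).
by rewrite /conf; field; have := dot_ge0 x; lra.
Qed.

Lemma is_derive_stereo x i :
  is_derive x (delta_mx 0 i) (stereo c) (stereo_frame x i).
Proof.
have Dx : is_derive x (delta_mx 0 i : 'rV[R]_(n + n.+1)) id (delta_mx 0 i).
  exact: is_derive_id.
have Df := is_derive_conf x i.
have Dc (a : R) := is_derive_fun_cst x (delta_mx 0 i) a.
have -> : stereo c = (fun y => @row_mx R 1 1 (n + n.+1)
    (((-1) ^+ c * (1 + - 1 * conf y)) *: (fun=> 1%:M) y) (conf y *: id y)).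
  by apply/funext => y; rewrite stereoE scalemx1 mulN1r.
have D1 : is_derive x (delta_mx 0 i) (fun=> 1%:M : 'M[R]_1) 0 by exact: is_derive_cst.
have D := is_derive_row_mx (is_derive_scale
    (is_derive_mul (Dc ((-1) ^+ c))
      (is_derive_add (Dc 1) (is_derive_mul (Dc (- 1)) Df))) D1)
  (is_derive_scale Df Dx).
apply: (is_derive_eq D).
rewrite /stereo_frame; congr (@row_mx R 1 1 (n + n.+1) _ _).
  by rewrite scaler0 addr0 scalemx1; congr (_%:M); ring.
by apply/rowP => j; rewrite !mxE; ring.
Qed.

Lemma sum_stereo_frame x : \sum_k x 0 k *: stereo_frame x k =
  @row_mx R 1 1 (n + n.+1) (((-1) ^+ c * (conf x ^+ 2 * dot x x))%:M)
    ((conf x - conf x ^+ 2 * dot x x) *: x).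
Proof.
apply/rowP => j; rewrite summxE [RHS]mxE.
under eq_bigr => k _ do rewrite 2!mxE.
case: (@fintype.split 1 (n + n.+1) j) => l.
  rewrite (ord1 l) mxE eqxx mulr1n /dot !mulr_sumr; apply: eq_bigr => k _.
  by rewrite mxE eqxx mulr1n; ring.
transitivity (conf x * (\sum_k (k == l)%:R * x 0 k)
    - conf x ^+ 2 * x 0 l * \sum_k x 0 k * x 0 k).
  rewrite -mulNr !mulr_sumr -big_split; apply: eq_bigr => k _ /=.
  by rewrite !mxE eqxx (eq_sym l k) /=; ring.
by rewrite sum_delta mxE /dot; ring.
Qed.

(** Gauss formula: the tangential part carries the round Christoffel symbols, the normal part is
    [- g_ai] times the position vector. *)
Lemma is_derive_stereo_frame x a i :
  is_derive x (delta_mx 0 a) (fun y => stereo_frame y i)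
    (- conf x *: (x 0 a *: stereo_frame x i + x 0 i *: stereo_frame x a
                  - (a == i)%:R *: \sum_k x 0 k *: stereo_frame x k)
     - (conf x ^+ 2 * (a == i)%:R) *: stereo c x).
Proof.
have Dx : is_derive x (delta_mx 0 a : 'rV[R]_(n + n.+1)) id (delta_mx 0 a).
  exact: is_derive_id.
have Df := is_derive_conf x a.
have Dxi := is_derive_coord x a i.
have Dc (a' : R) := is_derive_fun_cst x (delta_mx 0 a) a'.
have -> : (fun y => stereo_frame y i) = (fun y => @row_mx R 1 1 (n + n.+1)
    (((-1) ^+ c * (conf y * conf y * y 0 i)) *: (fun=> 1%:M) y)
    (conf y *: ((fun=> delta_mx 0 i) y + (- 1 * (conf y * y 0 i)) *: id y))).
  apply/funext => y; rewrite /stereo_frame scalemx1.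
  by congr (@row_mx R 1 1 (n + n.+1) _ (_ *: (_ + _))); rewrite mulN1r scaleNr.
have D1 : is_derive x (delta_mx 0 a) (fun=> 1%:M : 'M[R]_1) 0 by exact: is_derive_cst.
have De : is_derive x (delta_mx 0 a) (fun=> delta_mx 0 i : 'rV[R]_(n + n.+1)) 0.
  exact: is_derive_cst.
have D := is_derive_row_mx (is_derive_scale
    (is_derive_mul (Dc ((-1) ^+ c)) (is_derive_mul (is_derive_mul Df Df) Dxi)) D1)
  (is_derive_scale Df (is_derive_add De
     (is_derive_scale (is_derive_mul (Dc (- 1)) (is_derive_mul Df Dxi)) Dx))).
apply: (is_derive_eq D); rewrite sum_stereo_frame stereoE /stereo_frame.
have rE : dot x x = 2 / conf x - 1 by rewrite -(confE x); field; exact: conf_neq0.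
have f0 := conf_neq0 x; rewrite rE.
apply/rowP => j; rewrite !mxE.
case: (@fintype.split 1 (n + n.+1) j) => l; rewrite !mxE ?(ord1 l) ?eqxx /= ?mulr1n.
  by field.
by field.
Qed.

Lemma dot_sum_stereo_frame x v :
  dot (\sum_k x 0 k *: stereo_frame x k) v =
  \sum_k x 0 k * dot (stereo_frame x k) v.
Proof.
under [RHS]eq_bigr do rewrite -dotZl.
rewrite /dot exchange_big /=; apply: eq_bigr => i _.
by rewrite summxE mulr_suml.
Qed.

(** Parseval's identity: the frame divided by [conf x], together with the unit normal [stereo c x],
    is an orthonormal basis. The proof expands both sides after splitting off the first
    coordinate. *)
Lemma stereo_frame_complete x u v :
  \sum_k dot (stereo_frame x k) u * dot (stereo_frame x k) v =
  conf x ^+ 2 * (dot u v - dot u (stereo c x) * dot v (stereo c x)).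
Proof.
pose e : R := (-1) ^+ c; have ee : e * e = 1 by rewrite -expr2 sqrr_sign.
pose hd w : R := @lsubmx R 1 1 (n + n.+1) w 0 0.
pose tl w := @rsubmx R 1 1 (n + n.+1) w.
pose q w := e * hd w - dot x (tl w).
have dotE w w' : dot w w' = hd w * hd w' + dot (tl w) (tl w').
  rewrite -{1}[w](@hsubmxK R 1 1 (n + n.+1)) -{1}[w'](@hsubmxK R 1 1 (n + n.+1)).
  by rewrite (@dot_row_mx _ 1 (n + n.+1)) {1}/dot big_ord1.
have hdE a y : hd (@row_mx R 1 1 (n + n.+1) a%:M y) = a.
  by rewrite /hd row_mxKl !mxE mulr1n.
have tlE a y : tl (@row_mx R 1 1 (n + n.+1) a y) = y by rewrite /tl row_mxKr.
have frameE k w : dot (stereo_frame x k) w =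
    conf x * (conf x * x 0 k * q w + tl w 0 k).
  rewrite dotE /stereo_frame hdE tlE -/e.
  by rewrite dotZl dotDl dotNl dotZl dot_deltal /q; ring.
have stE w : dot w (stereo c x) = e * hd w - conf x * q w.
  by rewrite dotE stereoE hdE tlE -/e dotZr (dotC _ x) /q; ring.
transitivity (conf x ^+ 4 * q u * q v * dot x x
    + conf x ^+ 3 * q u * dot x (tl v) + conf x ^+ 3 * q v * dot x (tl u)
    + conf x ^+ 2 * dot (tl u) (tl v)).
  rewrite {3 4 5 6}/dot !mulr_sumr -!big_split; apply: eq_bigr => k _ /=.
  by rewrite !frameE; ring.
have xx : dot x x = 2 / conf x - 1 by rewrite -(confE x); field; exact: conf_neq0.
rewrite !stE xx (dotE u v).
have xtl w : dot x (tl w) = e * hd w - q w by rewrite /q; ring.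
have hh : hd u * hd v = (e * hd u) * (e * hd v) by rewrite mulrACA ee mul1r.
by rewrite !xtl hh; field; exact: conf_neq0.
Qed.

Lemma dot_stereo_frame x i j :
  dot (stereo_frame x i) (stereo_frame x j) = conf x ^+ 2 * (i == j)%:R.
Proof.
rewrite /stereo_frame (@dot_row_mx _ 1 (n + n.+1)) {1}/dot big_ord1 !mxE !eqxx !mulr1n.
rewrite !(dotDl, dotDr, dotNl, dotNr, dotZl, dotZr).
rewrite (dotC x (delta_mx 0 j)) !dot_deltal mulrACA -expr2 sqrr_sign mul1r.
have -> : dot x x = 2 / conf x - 1 by rewrite -(confE x); field; exact: conf_neq0.
by rewrite mxE eqxx /=; field; exact: conf_neq0.
Qed.

Lemma dot_stereo_frame_stereo x i : dot (stereo_frame x i) (stereo c x) = 0.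
Proof.
rewrite /stereo_frame stereoE (@dot_row_mx _ 1 (n + n.+1)) {1}/dot big_ord1.
rewrite !mxE !eqxx !mulr1n !(dotZl, dotZr) dotDl dotNl dotZl dot_deltal.
rewrite mulrACA -expr2 sqrr_sign mul1r.
have -> : dot x x = 2 / conf x - 1 by rewrite -(confE x); field; exact: conf_neq0.
by field; exact: conf_neq0.
Qed.

(** This lemma and the next five supply the identities assumed of [th] and [om] for contact
    metrics. *)
Lemma hopf_curvC x i j : hopf_curv i j x = - hopf_curv j i x.
Proof. exact: dot_mulI_skew. Qed.

Lemma sum_hopf_form2 x : \sum_i hopf_form i x * hopf_form i x = conf x ^+ 2.
Proof.
rewrite stereo_frame_complete dot_mulI (dotC (mulI _)) dot_mulIl.
by rewrite (stereo_sphere c x); ring.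
Qed.

Lemma sum_hopf_curv_form x k : \sum_i hopf_curv k i x * hopf_form i x = 0.
Proof.
rewrite stereo_frame_complete dot_mulI [X in _ - _ * X]dotC dot_mulIl.
by rewrite dot_stereo_frame_stereo; ring.
Qed.

(** Completeness applied to the images of two frame vectors under [mulI], whose normal components
    are the values of [- hopf_form]. *)
Lemma sum_hopf_curv2 x j k : \sum_i hopf_curv j i x * hopf_curv k i x =
  conf x ^+ 2 * (conf x ^+ 2 * (j == k)%:R - hopf_form j x * hopf_form k x).
Proof.
rewrite stereo_frame_complete dot_mulI dot_stereo_frame /hopf_form.
rewrite (dotC (mulI (stereo_frame x j))) (dotC (mulI (stereo_frame x k))).
by rewrite (dot_mulI_skew (stereo c x)) (dot_mulI_skew (stereo c x)); ring.
Qed.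

(** In the Gauss formula the normal term drops out, as [stereo c x] is orthogonal to its image under
    [mulI]; differentiating the second factor gives [hopf_curv a i]. *)
Lemma is_derive_hopf_form x a i :
  is_derive x (delta_mx 0 a) (hopf_form i)
    (form_deriv (conf x) (\sum_k x 0 k * hopf_form k x) (fun k => x 0 k)
         (hopf_form^~ x) (fun i j => hopf_curv i j x) a i).
Proof.
apply: (is_derive_eq (is_derive_dot (is_derive_stereo_frame x a i)
  (is_derive_mulI (is_derive_stereo x a)))).
rewrite !(dotDl, dotNl, dotZl) dot_sum_stereo_frame dot_mulIl.
by rewrite /form_deriv /hopf_form /hopf_curv; ring.
Qed.

(** Here the normal parts of both derivatives survive and give the terms in [hopf_form]. *)
Lemma is_derive_hopf_curv x a i j :
  is_derive x (delta_mx 0 a) (hopf_curv i j)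
    (curv_deriv (conf x) (fun k => x 0 k) (hopf_form^~ x)
         (fun k => \sum_i x 0 i * hopf_curv k i x)
         (fun i j => hopf_curv i j x) a i j).
Proof.
apply: (is_derive_eq (is_derive_dot (is_derive_stereo_frame x a j)
  (is_derive_mulI (is_derive_stereo_frame x a i)))).
rewrite (dot_mulI_skew (stereo_frame x j)) !(dotDl, dotNl, dotZl) !dot_sum_stereo_frame.
rewrite !(dot_mulI_skew (stereo c x)).
rewrite /curv_deriv -/(hopf_form j x) -/(hopf_form i x).
rewrite -/(hopf_curv i j x) -/(hopf_curv i a x) -/(hopf_curv j i x) -/(hopf_curv j a x).
rewrite (hopf_curvC x j i) (hopf_curvC x a j).
by rewrite /hopf_curv; ring.
Qed.

(** As [mulI p] is a unit vector, scaling the vertical part by [t] adds to the round metric [t - 1]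
    times the product of the vertical components. *)
Lemma bergerE t (p v w : 'rV[R]_(n.+1 + n.+1)) : sphere p ->
  berger t p v w = dot v w + (t - 1) * (dot v (mulI p) * dot w (mulI p)).
Proof.
rewrite /sphere /= => pp.
rewrite /berger /horizontal /vertical hopf_velocityE dot_mulI pp !divr1.
rewrite !(dotDl, dotDr, dotNl, dotNr, dotZl, dotZr) dot_mulI pp (dotC (mulI p)).
by ring.
Qed.

Lemma berger_sphereE t : berger_sphere n t c =
  contact_metric (t - 1) conf hopf_form.
Proof.
apply/funext => x; apply/matrixP => i j; rewrite !mxE bergerE; last first.
  exact: stereo_sphere.
rewrite !(@derive_val _ _ _ _ _ _ _ (is_derive_stereo x _)) dot_stereo_frame.
by [].
Qed.
End Stereo.

(** * Admissible [k] for Berger spheres, and the values of [Ein] and [ein] *)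

Section BergerEin.
Variables (R : realType) (n : nat).
Hypothesis n_gt0 : (1 <= n)%N.

Let N1 : (1 < n + n.+1)%N. Proof. by rewrite addnS ltnS addn_gt0 n_gt0. Qed.

Let NE : (n + n.+1)%:R = 2 * n%:R + 1 :> R.
Proof. by rewrite natrD -(addn1 n) natrD; ring. Qed.

Let m_ge1 : 1 <= n%:R :> R. Proof. by rewrite ler1n. Qed.

Lemma scal_berger (t : R) c x : 0 < t ->
  scal (berger_sphere n t c) x = 2 * n%:R * (2 * n%:R + 2 - t).
Proof.
move=> t0; have t1 : t - 1 + 1 != 0 by rewrite subrK gt_eqF.
rewrite berger_sphereE (scal_contact t1 (@conf_neq0 R n) (@confE R n)
  (hopf_curvC c) (sum_hopf_form2 c) (sum_hopf_curv_form c) (sum_hopf_curv2 c)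
  (@is_derive_conf R n) (is_derive_hopf_form c) (is_derive_hopf_curv c)) NE.
by ring.
Qed.

Lemma scal_pos_berger (t : R) : 0 < t ->
  scal_pos (berger_sphere n t) <-> t < 2 * n%:R + 2.
Proof.
have m0 : 0 < 2 * n%:R :> R by have := m_ge1; lra.
by move=> t0; split=> [/(_ true 0)|t2 c x]; rewrite scal_berger // pmulr_rgt0 // subr_gt0.
Qed.

(** The case [N = 2n + 1], [s = t - 1]: first the horizontal inequality, divided by [2], then the
    vertical one. Neither depends on the chart or the point. *)
Lemma ein_pos_berger (t k : R) : 0 < t ->
  ein_pos (berger_sphere n t) k <->
  k * (n%:R + 1 - t) < n%:R * (2 * n%:R + 2 - t) /\ k * t < 2 * n%:R + 2 - t.
Proof.
move=> t0; have t1 : t - 1 + 1 != 0 by rewrite subrK gt_eqF.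
have t1' : 0 < t - 1 + 1 by rewrite subrK.
have H c x := posdef_ein_contact t1 (@conf_neq0 R n) (@confE R n)
  (hopf_curvC c) (sum_hopf_form2 c) (sum_hopf_curv_form c) (sum_hopf_curv2 c)
  (@is_derive_conf R n) (is_derive_hopf_form c) (is_derive_hopf_curv c)
  k x N1 t1'.
have E : (0 < ((n + n.+1)%:R - 1) * ((n + n.+1)%:R - (t - 1))
      - k * ((n + n.+1)%:R - 1 - 2 * (t - 1))
    /\ 0 < ((n + n.+1)%:R - (t - 1)) - k * (t - 1 + 1)) <->
  k * (n%:R + 1 - t) < n%:R * (2 * n%:R + 2 - t) /\ k * t < 2 * n%:R + 2 - t.
  by rewrite NE; split=> -[? ?]; split; lra.
split=> [/(_ true 0)|K c x]; rewrite berger_sphereE; first by move=> /H/E.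
by apply/H/E.
Qed.

(** The hypothesis identifies the admissible set with the open interval from [0] to [e]; the bound
    [2n + 1] is the dimension in the definition of [Ein]. *)
Lemma Ein_berger_itv (t e : R) : 0 < t < 2 * n%:R + 2 -> 0 < e ->
  (forall k, 0 < k -> (k < e <-> k < 2 * n%:R + 1 /\
     k * (n%:R + 1 - t) < n%:R * (2 * n%:R + 2 - t) /\ k * t < 2 * n%:R + 2 - t)) ->
  Ein (berger_sphere n t) = e.
Proof.
move=> /andP[t0 t2] e0 ke; rewrite /Ein asboolT; last exact/scal_pos_berger.
rewrite (_ : [set k | _] = [set` `]0, e[]); first by rewrite sup_itv // bnd_simp.
apply/seteqP; split=> k /=; rewrite in_itv /= NE.
  by move=> [/andP[k0 kN] /(ein_pos_berger _ t0) K]; rewrite k0; apply/ke.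
move=> /andP[k0 /(ke _ k0) [kN K]]; split; first by rewrite k0.
by apply/ein_pos_berger.
Qed.

(** For [t >= 1] the vertical inequality implies the other two. *)
Lemma Ein_berger_ge1 (t : R) : 1 <= t < 2 * n%:R + 2 ->
  Ein (berger_sphere n t) = (2 * n%:R + 2) / t - 1.
Proof.
move=> /andP[t1 t2]; have t0 : 0 < t by lra.
have eE : (2 * n%:R + 2) / t - 1 = (2 * n%:R + 2 - t) / t by field; lra.
rewrite eE; apply: Ein_berger_itv => [||k k0]; first by rewrite t0.
  by rewrite divr_gt0 // subr_gt0.
rewrite ltr_pdivlMr //; split=> [kt|[_ []//]].
move: (n%:R : R) m_ge1 t2 kt => m m1 t2 kt.
have kD : k < 2 * m + 2 - t by nra.
split; first lra.
(* If [m + 1 - t <= 0] the left side is nonpositive; otherwise [k < 2m + 2 - t] and [m + 1 - t <= m]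
   give the bound. *)
split=> //; have [d0|d0] := leP (m + 1 - t) 0.
  have : 0 < m * (2 * m + 2 - t) by rewrite mulr_gt0; lra.
  by have : k * (m + 1 - t) <= 0 by [rewrite pmulr_rle0]; lra.
have : k * (m + 1 - t) < (2 * m + 2 - t) * (m + 1 - t) by rewrite ltr_pM2r.
by have : 0 <= (2 * m + 2 - t) * (t - 1) by [rewrite mulr_ge0; lra]; lra.
Qed.

Lemma ein_boundE (m t : R) : t != m + 1 ->
  m * (1 + (2 * m + 2) / (- (2 * t) + 2 * m + 2)) =
  m * (2 * m + 2 - t) / (m + 1 - t).
Proof.
move=> tn; field; apply/andP; split; apply: contra_neq tn; lra.
Qed.

(** [t] solves [m + m (m + 1) / (m + 1 - t) = r], another form of the bound; it provides the
    preimages for the ranges in (iii) and (iv). *)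
Lemma ein_bound_inv (m r : R) : 0 < m -> r != m ->
  let t := m + 1 - m * (m + 1) / (r - m) in
  m * (1 + (2 * m + 2) / (- (2 * t) + 2 * m + 2)) = r.
Proof.
move=> m0 rm t; have rm0 : r - m != 0 by rewrite subr_eq0.
have -> : - (2 * t) + 2 * m + 2 = 2 * m * (m + 1) / (r - m) by rewrite /t; field.
by field; rewrite rm0 /=; apply/andP; split; lra.
Qed.

(** For [t < 1] the horizontal inequality implies the other two. *)
Lemma Ein_berger_lt1 (t : R) : 0 < t < 1 -> Ein (berger_sphere n t) =
  n%:R * (1 + (2 * n%:R + 2) / (- (2 * t) + 2 * n%:R + 2)).
Proof.
move=> /andP[t0 t1]; have m1 := m_ge1; rewrite ein_boundE; last by rewrite lt_eqF //; lra.
have d0 : 0 < n%:R + 1 - t by lra.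
apply: Ein_berger_itv => [||k k0]; first by rewrite t0 /=; lra.
  by rewrite divr_gt0 // mulr_gt0; lra.
rewrite ltr_pdivlMr //; split=> [kt|[_ []//]].
move: (n%:R : R) m1 d0 kt => m m1 d0 kt.
(* This quantity is [(2m + 1)(m + 1 - t) - m (2m + 2 - t)] and also [(m + 1 - t) - m t]: the gaps
   behind the dimension bound and the vertical inequality. *)
have mt : 0 < (m + 1) * (1 - t) by rewrite mulr_gt0; lra.
split; first by rewrite -(ltr_pM2r d0); lra.
split=> //; rewrite -(ltr_pM2r d0).
have : k * (m + 1 - t) * t < m * (2 * m + 2 - t) * t by rewrite ltr_pM2r.
have : 0 < (2 * m + 2 - t) * ((m + 1) * (1 - t)) by rewrite mulr_gt0 //; lra.
lra.
Qed.

(** The coefficient [n + 1 - t] is now negative, so the horizontal inequality is a lower bound on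
    [k], while the vertical one holds for all [k < 0]. *)
Lemma ein_berger_gt (t : R) : n%:R + 1 < t < 2 * n%:R + 2 ->
  ein (berger_sphere n t)
  = (n%:R * (1 + (2 * n%:R + 2) / (- (2 * t) + 2 * n%:R + 2)))%:E.
Proof.
move=> /andP[t1 t2]; have m1 := m_ge1; have t0 : 0 < t by lra.
rewrite ein_boundE; last by rewrite gt_eqF //; lra.
rewrite /ein asboolT; last exact/scal_pos_berger.
have d0 : n%:R + 1 - t < 0 by lra.
set e := _ / _; have e0 : e < 0.
  by rewrite /e pmulr_rlt0 ?invr_lt0 // mulr_gt0; lra.
rewrite (_ : [set k | _] = [set` `]e, 0[]); last first.
  apply/seteqP; split=> k /=; rewrite in_itv /= [e < k]ltr_ndivrMr //.
    by move=> [k0 /(ein_pos_berger _ t0) [-> _]].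
  move=> /andP[ke k0]; split=> //; apply/ein_pos_berger => //; split=> //.
  by have : k * t < 0 by [rewrite nmulr_rlt0]; lra.
rewrite ereal_inf_EFin; first by rewrite inf_itv // bnd_simp.
  by exists e => k /=; rewrite in_itv => /andP[/ltW].
by exists (e / 2); rewrite /= in_itv /=; apply/andP; split; lra.
Qed.

(** Neither coefficient of [k] is negative and both right-hand sides are positive, so every [k < 0]
    is admissible. *)
Lemma ein_berger_le (t : R) : 0 < t <= n%:R + 1 -> ein (berger_sphere n t) = -oo%E.
Proof.
move=> /andP[t0 t1]; have m1 := m_ge1.
rewrite /ein asboolT; last by apply/scal_pos_berger => //; lra.
apply: eq_ninfty => r; pose k := Num.min r (-1).
have k0 : k < 0 by rewrite gt_min; apply/orP; right; lra.
apply: (@le_trans _ _ k%:E); last by rewrite lee_fin ge_min lexx.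
apply: ereal_inf_lbound; exists k => //; split=> //; apply/ein_pos_berger => //.
by split; move: (n%:R : R) m1 t1 => m m1 t1; nra.
Qed.
End BergerEin.

(** * Values and ranges in the five cases *)

Theorem proposition1p3 (R : realType) (n : nat) (hn : (1 <= n)%N) :
  [/\ (* (i) *)
      forall t : R, 2 * n%:R + 2 <= t ->
        Ein (berger_sphere n t) = 0 /\ ein (berger_sphere n t) = 0%E,
      (* (ii) *)
      (forall t : R, 1 <= t < 2 * n%:R + 2 ->
        Ein (berger_sphere n t) = (2 * n%:R + 2) / t - 1) /\
      [set Ein (berger_sphere n t) | t in [set t : R | 1 <= t < 2 * n%:R + 2]]
        = [set r : R | 0 < r <= 2 * n%:R + 1],
      (* (iii) *)
      (forall t : R, 0 < t < 1 ->
        Ein (berger_sphere n t)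
        = n%:R * (1 + (2 * n%:R + 2) / (- (2 * t) + 2 * n%:R + 2))) /\
      [set Ein (berger_sphere n t) | t in [set t : R | 0 < t < 1]]
        = [set r : R | 2 * n%:R < r < 2 * n%:R + 1],
      (* (iv) *)
      (forall t : R, n%:R + 1 < t < 2 * n%:R + 2 ->
        ein (berger_sphere n t)
        = (n%:R * (1 + (2 * n%:R + 2) / (- (2 * t) + 2 * n%:R + 2)))%:E) /\
      [set ein (berger_sphere n t)
         | t in [set t : R | n%:R + 1 < t < 2 * n%:R + 2]]
        = [set r%:E | r in [set r : R | r < 0]]
    & (* (v) *)
      forall t : R, 0 < t <= n%:R + 1 -> ein (berger_sphere n t) = -oo%E].
Proof.
have m1 : 1 <= n%:R :> R by rewrite ler1n.
split.
- move=> t t2; have t0 : 0 < t by lra.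
  (* The scalar curvature [2n (2n + 2 - t)] is not positive here, so both invariants take their
     default value [0]. *)
  have nsc : ~ scal_pos (berger_sphere n t).
    by move=> /(scal_pos_berger hn t0); rewrite ltNge t2.
  by rewrite /Ein /ein !asboolF.
- split; first exact: Ein_berger_ge1.
  apply/seteqP; split=> [_ [t /= t12 <-]|r /= /andP[r0 r1]].
    rewrite Ein_berger_ge1 //; move: t12 => /andP[t1 t2].
    rewrite subr_gt0 lerBlDr ltr_pdivlMr ?ler_pdivrMr; try lra.
    by apply/andP; split; [lra|move: (n%:R : R) m1 => m m1; nra].
  (* The preimage of [r] comes from solving [(2n + 2) / t - 1 = r] for [t]. *)
  have t12 : 1 <= (2 * n%:R + 2) / (r + 1) < 2 * n%:R + 2.
    rewrite ler_pdivlMr ?ltr_pdivrMr; try lra.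
    by apply/andP; split; [lra|move: (n%:R : R) m1 => m m1; nra].
  by exists ((2 * n%:R + 2) / (r + 1)) => //; rewrite Ein_berger_ge1 //; field; lra.
- split; first exact: Ein_berger_lt1.
  apply/seteqP; split=> [_ [t /= t01 <-]|r /= /andP[r0 r1]].
    rewrite Ein_berger_lt1 //; move: t01 => /andP[t0 t1].
    rewrite ein_boundE; last by rewrite lt_eqF //; lra.
    move: (n%:R : R) m1 => m m1.
    rewrite ltr_pdivlMr ?ltr_pdivrMr; try lra.
    by apply/andP; split; nra.
  set t := n%:R + 1 - n%:R * (n%:R + 1) / (r - n%:R).
  have t01 : 0 < t < 1.
    rewrite /t; move: (n%:R : R) m1 r0 r1 {t} => m m1 r0 r1.
    have q0 : m < m * (m + 1) / (r - m) by rewrite ltr_pdivlMr; nra.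
    have q1 : m * (m + 1) / (r - m) < m + 1 by rewrite ltr_pdivrMr; nra.
    by apply/andP; split; lra.
  by exists t => //; rewrite Ein_berger_lt1 // ein_bound_inv //; [|rewrite gt_eqF]; lra.
- split; first exact: ein_berger_gt.
  apply/seteqP; split=> [_ [t /= t12 <-]|_ [r /= r0 <-]].
    rewrite ein_berger_gt //; move: t12 => /andP[t1 t2].
    exists (n%:R * (2 * n%:R + 2 - t) / (n%:R + 1 - t)).
      by rewrite /= pmulr_rlt0 ?invr_lt0 ?mulr_gt0; lra.
    by rewrite ein_boundE // gt_eqF.
  set t := n%:R + 1 - n%:R * (n%:R + 1) / (r - n%:R).
  have t12 : n%:R + 1 < t < 2 * n%:R + 2.
    rewrite /t; move: (n%:R : R) m1 {t} => m m1.
    (* As [r < 0 < m], the sign change makes the denominator positive; [t - (m + 1)] is then a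
       quotient between [0] and [m + 1]. *)
    have -> : m * (m + 1) / (r - m) = - (m * (m + 1) / (m - r)) by field; lra.
    have q0 : 0 < m * (m + 1) / (m - r) by rewrite divr_gt0 ?mulr_gt0; lra.
    have q1 : m * (m + 1) / (m - r) < m + 1 by rewrite ltr_pdivrMr; nra.
    by apply/andP; split; lra.
  exists t => //; rewrite ein_berger_gt // ein_bound_inv //; [lra|].
  by rewrite lt_eqF //; lra.
- exact: ein_berger_le.
Qed.
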